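(* Let $k\geq 4$ and let $\tau=\tau_1\cdots\tau_{k-2}21\in S_k$ be a pattern whose last two letters are $2$ and $1$ (i.e. $\tau_{k-1}=2$ and $\tau_k=1$). Then for every integer $n\geq 2$, $$a_n(\tau,4321;213)=a_n(\tau^{-1},4321;312)=F_{2n-3},$$ where $\tau^{-1}$ is the inverse permutation of $\tau$ and $F_m$ is the $m$-th Fibonacci number.
   Context: A permutation $\pi$ of $[n]=\{1,\dots,n\}$ is cyclic if it consists of a single $n$-cycle. Its one-line notation is $\pi_1\pi_2\cdots\pi_n$ with $\pi_i=\pi(i)$. Its standard cycle form is $(c_1,c_2,\dots,c_n)$ with $c_1=1$ and $c_{i+1}=\pi(c_i)$ for $1\le i<n$ (the cycle written starting at $1$). A sequence $w_1\cdots w_n$ of distinct integers contains a pattern $\sigma=\sigma_1\cdots\sigma_k\in S_k$ if there are indices $i_1<\dots<i_k$ with $w_{i_s}>w_{i_t}$ iff $\sigma_s>\sigma_t$ for all $1\le s<t\le k$; otherwise it avoids $\sigma$. For patterns $\sigma_1,\dots,\sigma_l,\rho$, $\mathcal{A}_n(\sigma_1,\dots,\sigma_l;\rho)$ is the set of cyclic permutations of $[n]$ whose one-line notation avoids each $\sigma_i$ and whose standard cycle form $c_1c_2\cdots c_n$, read as a sequence, avoids $\rho$; and $a_n(\sigma_1,\dots,\sigma_l;\rho)=|\mathcal{A}_n(\sigma_1,\dots,\sigma_l;\rho)|$. Fibonacci numbers: $F_0=0$, $F_1=1$, $F_m=F_{m-1}+F_{m-2}$ for $m\ge 2$. *)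

(* Defs.v *)
From mathcomp Require Import all_boot all_fingroup.

Set Implicit Arguments.
Unset Strict Implicit.
Unset Printing Implicit Defensive.

(* A permutation of [n] is s : 'S_n; the ordinal i stands for the letter i+1. *)

Definition oneline (n : nat) (s : 'S_n) : seq nat :=
  [seq (val (s i)).+1 | i <- enum 'I_n].

(* For n = 0 there is no letter 1 to start from, and the word is empty. *)
Definition cycle_form (n : nat) : 'S_n -> seq nat :=
  match n return 'S_n -> seq nat with
  | 0 => fun _ => [::]
  | m.+1 => fun s => [seq (val c).+1 | c <- traject s ord0 m.+1]
  end.

Definition cyclic_perm (n : nat) (s : 'S_n) : bool := #|porbits s| == 1.

Definition contains (w sigma : seq nat) : bool :=
  [exists f : {ffun 'I_(size sigma) -> 'I_(size w)},
    [forall s : 'I_(size sigma), forall t : 'I_(size sigma), (s < t) ==>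
      (f s < f t) &&
      ((nth 0 w (f s) > nth 0 w (f t)) == (nth 0 sigma s > nth 0 sigma t))]].

Definition avoids (w sigma : seq nat) : bool := ~~ contains w sigma.

Definition A_set (n : nat) (sigmas : seq (seq nat)) (rho : seq nat) :
    {set 'S_n} :=
  [set s : 'S_n | [&& cyclic_perm s,
                      all (avoids (oneline s)) sigmas
                    & avoids (cycle_form s) rho]].

Definition a_num (n : nat) (sigmas : seq (seq nat)) (rho : seq nat) : nat :=
  #|A_set n sigmas rho|.

Fixpoint fib (m : nat) : nat :=
  match m with
  | 0 => 0
  | 1 => 1
  | (p.+1 as q).+1 => fib q + fib p
  end.

(* Main.v *)
(** Write a cyclic permutation pi as the word 0 e, its cycle form shifted to
    start from 0, so that inversion reverses e; this gives the first equality.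
    If e avoids 213, the letters before 1 exceed those after it, and then
    avoiding 4321 in one-line notation forces 1 to be the first letter of e, the
    last one, or the one just before 2. Deleting 1 and shifting the other
    letters down gives a word of the same kind, and each of the three insertions
    can be undone; none creates in one-line notation a pattern 3421 or 4321, so
    all these permutations avoid every tau ending in 21. If f and g count
    the words of length k and those not beginning with 1, the insertions give
    f' = 2 f + g and g' = f + g for length k + 1, the recursion of consecutive
    Fibonacci numbers. *)

Require Import Defs.
From mathcomp Require Import all_boot all_fingroup.
From mathcomp Require Import zify.

Set Implicit Arguments.
Unset Strict Implicit.
Unset Printing Implicit Defensive.

(** * Words of cycles, their graphs and the forbidden patterns *)

(* The graph of the cycle (x s), whose last letter is sent back to 0. *)
Fixpoint edges (x : nat) (s : seq nat) : seq (nat * nat) :=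
  if s is y :: s' then (x, y) :: edges y s' else [:: (x, 0)].

(* For [strict = true] this is an occurrence of 4321, otherwise of 4321 or 3421. *)
Definition descent_pattern (strict : bool) (E : seq (nat * nat)) : Prop :=
  exists i j k l a b c d : nat,
    [/\ (i, a) \in E, (j, b) \in E, (k, c) \in E & (l, d) \in E] /\
    [/\ i < j, j < k & k < l] /\ [/\ d < c, c < a, c < b & strict ==> (b < a)].

Definition avoids213 (s : seq nat) : Prop :=
  forall a b c : nat, subseq [:: a; b; c] s -> ~~ (b < a < c).

Lemma unzip1_edges x s : unzip1 (edges x s) = x :: s.
Proof. by elim: s x => //= y s IH x; rewrite IH. Qed.

Lemma unzip2_edges x s : unzip2 (edges x s) = rcons s 0.
Proof. by elim: s x => //= y s IH x; rewrite IH. Qed.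

Lemma edges_cat x s1 s2 :
  edges x (s1 ++ s2) = zip (belast x s1) s1 ++ edges (last x s1) s2.
Proof. by elim: s1 x => //= y s1 IH x; rewrite IH. Qed.

Lemma edges_to0 x y s : 0 \notin s -> (y, 0) \in edges x s -> y = last x s.
Proof.
elim: s x => [|z s IH] x /=; first by rewrite inE => _ /eqP[].
by rewrite !inE => /norP[z0 n0] /orP[/eqP[_ e]|/(IH _ n0)//]; rewrite e eqxx in z0.
Qed.

Lemma edges_step x s1 y s2 : (last x s1, y) \in edges x (s1 ++ y :: s2).
Proof. by rewrite edges_cat mem_cat inE eqxx orbT. Qed.

(** Only the edge across the insertion point changes. The default 0 of [last] and [head] is the
    letter where the cycle starts and closes, so both ends are covered. *)
Lemma edges_insert s1 s2 : exists R,
  perm_eq (edges 0 (s1 ++ s2)) ((last 0 s1, head 0 s2) :: R) /\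
  perm_eq (edges 0 (s1 ++ 1 :: s2)) [:: (last 0 s1, 1), (1, head 0 s2) & R].
Proof.
exists (zip (belast 0 s1) s1 ++ if s2 is y :: s' then edges y s' else [::]).
split; rewrite edges_cat; apply/seq.permP => P; rewrite !count_cat;
  by case: s2 => [|y s2] /=; rewrite ?count_cat /=; lia.
Qed.

(** Occurrences are transported by relabelling positions and values. Monotonicity is asked only on
    letters that occur, since the relabellings used below are not monotone on all numbers. *)
Lemma descent_pattern_homo b E E' (f g : nat -> nat) :
  (forall x y, (x, y) \in E -> (f x, g y) \in E') ->
  {in unzip1 E &, {homo f : x y / x < y}} ->
  {in unzip2 E &, {homo g : x y / x < y}} ->
  descent_pattern b E -> descent_pattern b E'.
Proof.
move=> EE' fH gH [i [j [k [l [x [y [z [t [[hi hj hk hl]]]]]]]]]].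
move=> [[ij jk kl] [tz zx zy yx]].
have m1 u v : (u, v) \in E -> u \in unzip1 E by exact: (map_f fst).
have m2 u v : (u, v) \in E -> v \in unzip2 E by exact: (map_f snd).
exists (f i), (f j), (f k), (f l), (g x), (g y), (g z), (g t).
split; first by split; apply: EE'.
split; first by split; apply: fH; rewrite ?(m1 _ _ hi, m1 _ _ hj, m1 _ _ hk, m1 _ _ hl).
split; try by apply: gH; rewrite ?(m2 _ _ hi, m2 _ _ hj, m2 _ _ hk, m2 _ _ hl).
by apply/implyP=> /(implyP yx); apply: gH; rewrite ?(m2 _ _ hi, m2 _ _ hj).
Qed.

Lemma perm_descent_pattern b E E' :
  perm_eq E E' -> descent_pattern b E -> descent_pattern b E'.
Proof.
by move=> /perm_mem eE; apply: (descent_pattern_homo (f := id) (g := id)) => // x y;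
  rewrite eE.
Qed.

(** * Effect on the graph of deleting and inserting 1 *)

(* [R] is the graph of the permutation outside [p], which is sent to [q]; the
   letter [1] is inserted between them. The three cases are those of the
   insertion at the front of the word, at its end, and just before [2]. *)
Definition harmless_insertion (p q : nat) (R : seq (nat * nat)) : Prop :=
  [/\ p != 1, q != 1,
      (forall x y : nat, (x, y) \in R -> [/\ x != p, x != 1, y != q & y != 1])
    & [\/ p = 0, q = 0 | q = 2 /\ forall x, (x, 0) \in R -> x < p]].

(** If [p = 0], the value 1 at position 0 is too small to open an occurrence, and position 1 can be
    renamed 0. Otherwise position 1 takes no part, and the value 1 at [p] can be renamed [q]. *)
Lemma descent_pattern_delete p q R b : harmless_insertion p q R ->
  descent_pattern b [:: (p, 1), (1, q) & R] -> descent_pattern b ((p, q) :: R).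
Proof.
move=> [p1 q1 HR H] D.
have inR u v : (u, v) \in [:: (p, 1), (1, q) & R] ->
    [\/ u = p /\ v = 1, u = 1 /\ v = q | (u, v) \in R].
  by rewrite !inE => /or3P[/eqP[-> ->]|/eqP[-> ->]|->];
    [apply: Or31|apply: Or32|apply: Or33].
have [p0|pn0] := eqVneq p 0.
  have {}D : descent_pattern b ((1, q) :: R).
    case: D => i [j [k [l [x [y [z [t [[hi hj hk hl]]]]]]]]].
    move=> [[ij jk kl] [tz zx zy yx]].
    have ge2 u v : 1 < u -> (u, v) \in [:: (p, 1), (1, q) & R] -> (u, v) \in R.
      by move=> u1 /inR[[e _]|[e _]|//]; exfalso; lia.
    have i0 : 0 < i.
      case/inR: hi => [[_ e]|[-> //]|/HR[]]; first by exfalso; lia.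
      by rewrite p0 lt0n.
    exists i, j, k, l, x, y, z, t; do 2![split=> //].
    - by case/inR: hi => [[e _]|[-> ->]|h]; rewrite inE ?eqxx ?h ?orbT //; exfalso; lia.
    - by rewrite inE ge2 ?orbT //; lia.
    - by rewrite inE ge2 ?orbT //; lia.
    - by rewrite inE ge2 ?orbT //; lia.
  have R2 u : u \in unzip1 R -> 1 < u.
    by case/mapP=> -[u' v] /HR[up u1 _ _] /= ->; lia.
  apply: (descent_pattern_homo (f := fun u => if u == 1 then 0 else u) (g := id)) D => //.
    move=> u v; rewrite !inE => /orP[/eqP[-> ->]|uvR]; first by rewrite p0 /= eqxx.
    by have [_ /negPf-> _ _] := HR _ _ uvR; rewrite uvR orbT.
  by move=> u v /=; rewrite !inE => /orP[/eqP->|/R2 hu] /orP[/eqP->|/R2 hv];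
    rewrite /=; repeat case: ifP => /=; lia.
have {H pn0} [q02 H0] : (q = 0 \/ q = 2) /\
    (q = 2 -> forall x, (x, 0) \in R -> x < p).
  case: H => [e|->|[-> ?]]; first by rewrite e eqxx in pn0.
    by split; [left|].
  by split; [right|].
have {}D : descent_pattern b ((p, 1) :: R).
  case: D => i [j [k [l [x [y [z [t [[hi hj hk hl]]]]]]]]].
  move=> [[ij jk kl] [tz zx zy yx]].
  have no1 u v : u < k -> z < v -> (u, v) \in [:: (p, 1), (1, q) & R] ->
      (u, v) \in (p, 1) :: R.
    move=> uk zv /inR[[-> ->]|[u1 vq]|h]; rewrite inE ?eqxx ?h ?orbT //.
    (* Position 1 could only hold one of the two large letters. Then [q = 2], and the small ones are
       1, at [p], and 0, further right; but 0 stands to the left of [p]. *)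
    exfalso; case: q02 => q02; first lia.
    have kp : k = p.
      by case/inR: hk => [[-> //]|[]|/HR[_ _ _ z1]]; [lia|exfalso; lia].
    case/inR: hl => [[]|[]|]; [lia|lia|have ->: t = 0 by lia].
    by move/(H0 q02); lia.
  have ge2 u v : 1 < u -> (u, v) \in [:: (p, 1), (1, q) & R] -> (u, v) \in (p, 1) :: R.
    by move=> u1 /inR[[-> ->]|[e _]|h]; rewrite inE ?eqxx ?h ?orbT //; exfalso; lia.
  by exists i, j, k, l, x, y, z, t; do 2![split=> //];
    [apply: no1|apply: no1|apply: ge2|apply: ge2] => //; lia.
have R2 v : v \in unzip2 R -> v <> 1 /\ v <> q.
  by case/mapP=> -[u' w] /HR[_ _ vq v1] /= ->; split; apply/eqP.
apply: (descent_pattern_homo (f := id) (g := fun v => if v == 1 then q else v)) D => //.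
  move=> u v; rewrite !inE => /orP[/eqP[-> ->]|uvR]; first by rewrite /= eqxx.
  by have [_ _ _ /negPf->] := HR _ _ uvR; rewrite uvR orbT.
by move=> u v /=; rewrite !inE => /orP[/eqP->|/R2[? ?]] /orP[/eqP->|/R2[? ?]];
  rewrite ?eqxx /=; repeat case: ifP => /=; lia.
Qed.

(** The reverse renaming, of position 0 or of value [q] to 1, keeps the order because [R] has
    nothing in between. *)
Lemma descent_pattern_insert p q R b : harmless_insertion p q R ->
  descent_pattern b ((p, q) :: R) -> descent_pattern b [:: (p, 1), (1, q) & R].
Proof.
move=> [p1 q1 HR H].
have [p0|pn0] := eqVneq p 0.
  have R2 u : u \in unzip1 R -> 1 < u.
    by case/mapP=> -[u' v] /HR[up u1 _ _] /= ->; lia.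
  apply: (descent_pattern_homo (f := fun u => if u == 0 then 1 else u) (g := id)) => //.
    move=> u v; rewrite !inE => /orP[/eqP[-> ->]|uvR]; first by rewrite p0 /= eqxx ?orbT.
    by rewrite -p0; have [/negPf-> _ _ _] := HR _ _ uvR; rewrite uvR !orbT.
  by move=> u v /=; rewrite !inE => /orP[/eqP->|/R2 hu] /orP[/eqP->|/R2 hv];
    rewrite /=; repeat case: ifP => /=; lia.
have q02 : q = 0 \/ q = 2.
  by case: H => [e|->|[-> _]]; [rewrite e eqxx in pn0|left|right].
have R2 v : v \in unzip2 R -> v <> 1 /\ v <> q.
  by case/mapP=> -[u' w] /HR[_ _ vq v1] /= ->; split; apply/eqP.
apply: (descent_pattern_homo (f := id) (g := fun v => if v == q then 1 else v)) => //.
  move=> u v; rewrite !inE => /orP[/eqP[-> ->]|uvR]; first by rewrite eqxx /= eqxx.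
  by have [_ _ /negPf-> _] := HR _ _ uvR; rewrite uvR !orbT.
by move=> u v /=; rewrite !inE => /orP[/eqP->|/R2[? ?]] /orP[/eqP->|/R2[? ?]];
  rewrite ?eqxx /=; repeat case: ifP => /=; lia.
Qed.

Lemma harmless_insertionP s1 s2 R :
  uniq (s1 ++ 1 :: s2) -> 0 \notin s1 ++ 1 :: s2 ->
  perm_eq (edges 0 (s1 ++ 1 :: s2)) [:: (last 0 s1, 1), (1, head 0 s2) & R] ->
  [\/ s1 = [::], s2 = [::] |
    [/\ head 0 s2 = 2 & forall a c, a \in s1 -> c \in s2 -> c < a]] ->
  harmless_insertion (last 0 s1) (head 0 s2) R.
Proof.
move=> Us n0 pE H.
(* Every letter is the source of one edge and the target of one, so [R] avoids the ends already
   taken. *)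
have U0 : uniq (0 :: s1 ++ 1 :: s2) by rewrite cons_uniq n0.
have U1 := perm_uniq (perm_map fst pE).
have U2 := perm_uniq (perm_map snd pE).
rewrite -/unzip1 unzip1_edges U0 /= !inE in U1.
rewrite -/unzip2 unzip2_edges rcons_uniq n0 Us /= !inE in U2.
move/esym: U1 => /and3P[/norP[p1 pR] R1 _].
move/esym: U2 => /and3P[/norP[q1 oR] qR _].
split; rewrite // 1?eq_sym //.
- move=> x y xyR; have xR := map_f fst xyR; have yR := map_f snd xyR.
  split; apply/negP => /eqP e; subst.
  + by rewrite xR in pR.
  + by rewrite xR in R1.
  + by rewrite yR in qR.
  + by rewrite yR in oR.
case: H => [->|->|[h2 lt21]]; [exact: Or31|exact: Or32|].
have [->|s1n] := eqVneq s1 [::]; [exact: Or31|apply: Or33; split=> //].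
move=> x xR.
(* The letter sent to 0 is the last one; it lies in [s2], hence below the last letter of [s1]. *)
have ->: x = last 0 (s1 ++ 1 :: s2).
  by apply: edges_to0 => //; rewrite (perm_mem pE) !inE xR !orbT.
case: s2 h2 lt21 {n0 Us pE U0 q1 qR} => //= c s2 _ lt21.
case: s1 s1n lt21 {xR p1 pR} => //= a s1 _ lt21.
by rewrite last_cat /=; apply: lt21; rewrite mem_last.
Qed.

(** * Shifting letters, and avoidance of 213 *)

Lemma map_edges (f : nat -> nat) x s : f 0 = 0 ->
  edges (f x) (map f s) = [seq (f e.1, f e.2) | e <- edges x s].
Proof. by move=> f0; elim: s x => [|y s IH] x /=; rewrite ?f0 ?IH. Qed.

Lemma edges_map_succ e : 0 \notin e ->
  edges 0 (map S e) = [seq (if p.1 == 0 then 0 else p.1.+1,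
                            if p.2 == 0 then 0 else p.2.+1) | p <- edges 0 e].
Proof.
move=> n0; pose f x := if x == 0 then 0 else x.+1.
have ->: map S e = map f e.
  by apply/eq_in_map => x xe; rewrite /f; case: eqP => // x0; rewrite -x0 xe in n0.
by rewrite -[X in edges X _]/(f 0) map_edges.
Qed.

Lemma descent_pattern_succ b e : 0 \notin e ->
  descent_pattern b (edges 0 e) <-> descent_pattern b (edges 0 (map S e)).
Proof.
move=> /edges_map_succ->; pose f x := if x == 0 then 0 else x.+1.
split.
  apply: (descent_pattern_homo (f := f) (g := f)).
  - by move=> x y /(map_f (fun p => (f p.1, f p.2))).
  - by rewrite /f => x y _ _; repeat case: ifP; lia.
  - by rewrite /f => x y _ _; repeat case: ifP; lia.
(* [predn] is strictly monotone on the letters concerned because [f] never takes the value 1. *)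
have fK : cancel f predn by move=> [].
apply: (descent_pattern_homo (f := predn) (g := predn)).
- by move=> x y /mapP[[u v] uv [-> ->]]; rewrite !fK.
- move=> x y; rewrite /unzip1 -map_comp => /mapP[[u ?] _ ->] /mapP[[v ?] _ ->] /=.
  by rewrite !fK /f; repeat case: ifP; lia.
- move=> x y; rewrite /unzip2 -map_comp => /mapP[[? u] _ ->] /mapP[[? v] _ ->] /=.
  by rewrite !fK /f; repeat case: ifP; lia.
Qed.

Lemma avoids213_subseq s1 s2 : subseq s1 s2 -> avoids213 s2 -> avoids213 s1.
Proof. by move=> s12 H a b c /subseq_trans/(_ s12)/H. Qed.

Lemma avoids213_succ e : avoids213 e <-> avoids213 (map S e).
Proof.
split=> H a b c.
  move=> sub; have /mapP[b' _ eb] : b \in map S e.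
    by apply: (mem_subseq sub); rewrite !inE eqxx orbT.
  by move/(map_subseq predn): sub; rewrite mapK // => /H /=; lia.
by move/(map_subseq S)/H.
Qed.

(** The new letter is the minimum, so it could only be the middle of a 213, whose outer letters
    would then contradict the hypothesis on [s1] and [s2]. *)
Lemma avoids213_insert s1 s2 : 0 \notin s1 ++ s2 -> uniq (s1 ++ 1 :: s2) ->
  (forall a c, a \in s1 -> c \in s2 -> c < a) ->
  avoids213 (s1 ++ s2) -> avoids213 (s1 ++ 1 :: s2).
Proof.
move=> n0 U lt21 H a b c sub.
have := U; rewrite cat_uniq /= negb_or => /and4P[_ /andP[n1 _] n2 _].
have n0' : 0 \notin s1 ++ 1 :: s2.
  by move: n0; rewrite !mem_cat inE.
have F (t : seq nat) : 1 \notin t -> filter (predC1 1) t = t.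
  by move=> nt; apply/all_filterP/allP => x xt; apply: contraNneq nt => <-.
apply/negP=> /andP[ba ac].
have b0 : b != 0.
  have bw : b \in s1 ++ 1 :: s2 by apply: (mem_subseq sub); rewrite !inE eqxx orbT.
  by apply: contraNneq n0' => e; rewrite e in bw.
have [b1|b1] := eqVneq b 1; last first.
  have /H : subseq [:: a; b; c] (s1 ++ s2).
    have ->: s1 ++ s2 = filter (predC1 1) (s1 ++ 1 :: s2).
      by rewrite filter_cat /= !F.
    by rewrite subseq_filter sub andbT /= b1 !andbT; apply/andP; split; lia.
  by rewrite ba ac.
(* Without repetitions a subsequence is the filter by its own letters; splitting at 1 puts [a] in
   [s1] and [c] in [s2]. *)
subst b; move/(subseq_uniqP U): sub.
rewrite filter_cat /= !inE eqxx orbT /=.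
set F1 := filter _ s1; set F2 := filter _ s2 => eF.
have F1s : {subset F1 <= s1} by apply/mem_subseq/filter_subseq.
have F2s : {subset F2 <= s2} by apply/mem_subseq/filter_subseq.
move: eF F1s F2s; case: F1 => [|x [|y F1]] /= [].
- by move=> a1; move: ba; rewrite a1.
- move=> <- <- F1s F2s; have := lt21 a c; rewrite F1s ?F2s ?inE //.
  by move=> /(_ isT isT); lia.
- by move=> _ <- _ F1s; rewrite F1s ?inE ?eqxx ?orbT in n1.
Qed.

(** Otherwise [a], 1, [c] would form a 213. *)
Lemma avoids213_around1 s1 s2 : 0 \notin s1 ++ 1 :: s2 -> uniq (s1 ++ 1 :: s2) ->
  avoids213 (s1 ++ 1 :: s2) -> forall a c, a \in s1 -> c \in s2 -> c < a.
Proof.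
move=> n0 U H a c as1 cs2.
have /H : subseq [:: a; 1; c] (s1 ++ 1 :: s2).
  rewrite -[[:: a; 1; c]]/([:: a] ++ [:: 1; c]); apply: cat_subseq.
    by rewrite sub1seq.
  by rewrite /= sub1seq.
have a0 : a != 0 by apply: contraNneq n0 => <-; rewrite mem_cat as1.
move: U; rewrite cat_uniq /= negb_or => /and3P[_ /andP[n1 /hasPn n12] _].
have a1 : a != 1 by apply: contraNneq n1 => <-.
have /= ac := n12 _ cs2.
have : a != c by apply: contraNneq ac => <-.
lia.
Qed.

(** * Good words and the three insertions *)

Definition insert1 (i : nat) (e : seq nat) : seq nat :=
  map S (take i e) ++ 1 :: map S (drop i e).

(* The initial 0 of the cycle is omitted from the word. *)
Definition good_word (b : bool) (k : nat) (e : seq nat) : Prop :=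
  [/\ perm_eq e (iota 1 k), avoids213 e & ~ descent_pattern b (edges 0 e)].

Lemma perm_iota1_notin0 k e : perm_eq e (iota 1 k) -> 0 \notin e.
Proof. by move=> /perm_mem->; rewrite mem_iota. Qed.

Lemma perm_insert1 i k e :
  perm_eq (insert1 i e) (iota 1 k.+1) = perm_eq e (iota 1 k).
Proof.
rewrite /insert1 -[1 :: map S _]cat1s perm_catCA /= perm_cons -map_cat cat_take_drop.
rewrite (iotaDl 1 1) (eq_map (g := S)); last by move=> x; rewrite add1n.
apply/idP/idP; last exact: perm_map.
exact: (perm_map_inj succn_inj).
Qed.

Lemma good_word_insert1 b k i e : good_word b k e ->
  [\/ i = 0, i = size e | i = index 1 e] -> good_word b k.+1 (insert1 i e).
Proof.
move=> [pe He De] Hi.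
have p' : perm_eq (insert1 i e) (iota 1 k.+1) by rewrite perm_insert1.
have U : uniq (insert1 i e) by rewrite (perm_uniq p') iota_uniq.
have n0 := perm_iota1_notin0 pe; have n0' := perm_iota1_notin0 p'.
have lt21 : forall a c, a \in map S (take i e) -> c \in map S (drop i e) -> c < a.
  move=> _ _ /mapP[a ae ->] /mapP[c ce ->]; rewrite ltnS.
  case: Hi => ei; move: ae ce; rewrite ei ?take0 ?drop_size //.
  (* If 1 is absent, [index] returns the size and nothing follows the insertion point. *)
  have [e1|ne1] := boolP (1 \in e); last by rewrite memNindex // drop_size.
  have Ue : uniq e by rewrite (perm_uniq pe) iota_uniq.
  have := cat_take_drop (index 1 e) e; rewrite drop_index // => ee.
  rewrite -ee in n0 He Ue => ae; rewrite inE => /orP[/eqP->|ce]; last first.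
    by apply: avoids213_around1 n0 Ue He a c ae ce.
  move: Ue; rewrite cat_uniq /= negb_or => /and3P[_ /andP[n1 _] _].
  have a1 : a != 1 by apply: contraNneq n1 => ea; rewrite -{1}ea.
  have : a \in iota 1 k by rewrite -(perm_mem pe) (mem_take ae).
  by rewrite mem_iota; lia.
have eS : map S (take i e) ++ map S (drop i e) = map S e.
  by rewrite -map_cat cat_take_drop.
split=> //.
  apply: avoids213_insert => //; rewrite eS; last by apply/(avoids213_succ e).1.
  by apply/mapP=> -[].
(* An occurrence in the new word contracts to one in the shifted old word, hence to one in the old
   word. *)
move=> D; apply: De; apply/descent_pattern_succ => //; rewrite -eS.
have [R [p1 p2]] := edges_insert (map S (take i e)) (map S (drop i e)).
move/(perm_descent_pattern p2): D => D.
rewrite perm_sym in p1; apply: (perm_descent_pattern p1).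
apply: descent_pattern_delete D; apply: harmless_insertionP => //.
case: Hi => ei; first by rewrite ei take0; apply: Or31.
  by rewrite ei drop_size; apply: Or32.
have [e1|ne1] := boolP (1 \in e); last first.
  by rewrite ei memNindex // drop_size; apply: Or32.
by apply: Or33; split=> //; rewrite ei drop_index.
Qed.

(** Deleting 1 leaves a subsequence, and an occurrence in the smaller graph would expand to one in
    the larger. *)
Lemma insert1_good_word b k i e : good_word b k.+1 (insert1 i e) ->
  [\/ i = 0, i = size e | i = index 1 e] -> good_word b k e.
Proof.
move=> [p' H' D'] Hi.
have pe : perm_eq e (iota 1 k) by rewrite -(perm_insert1 i).
have U : uniq (insert1 i e) by rewrite (perm_uniq p') iota_uniq.
have n0 := perm_iota1_notin0 pe; have n0' := perm_iota1_notin0 p'.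
have eS : map S (take i e) ++ map S (drop i e) = map S e.
  by rewrite -map_cat cat_take_drop.
split=> //.
  apply/avoids213_succ; apply: avoids213_subseq H'.
  by rewrite -eS /insert1; apply: cat_subseq => //; apply: subseq_cons.
move=> /(descent_pattern_succ _ n0) D; apply: D'.
have [R [p1 p2]] := edges_insert (map S (take i e)) (map S (drop i e)).
rewrite -eS in D; move/(perm_descent_pattern p1): D => D.
rewrite perm_sym in p2; apply: (perm_descent_pattern p2).
apply: descent_pattern_insert D; apply: harmless_insertionP => //.
  by rewrite perm_sym.
case: Hi => ei; first by rewrite ei take0; apply: Or31.
  by rewrite ei drop_size; apply: Or32.
have [e1|ne1] := boolP (1 \in e); last first.
  by rewrite ei memNindex // drop_size; apply: Or32.
apply: Or33; split=> //; first by rewrite ei drop_index.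
exact: avoids213_around1 n0' U H'.
Qed.

(* If [1] is neither first nor last nor just before [2], then the values of pi
   at 0, 1, pi^-1 2 and pi^-1 1 form an occurrence of 4321. *)
Lemma good_word_position k s1 s2 : good_word true k (s1 ++ 1 :: s2) ->
  [\/ s1 = [::], s2 = [::] | head 0 s2 = 2].
Proof.
move=> [p H D].
have U : uniq (s1 ++ 1 :: s2) by rewrite (perm_uniq p) iota_uniq.
have n0 := perm_iota1_notin0 p.
have lt21 := avoids213_around1 n0 U H.
case: s1 => [|a s1] in p H D U n0 lt21 *; first exact: Or31.
case: s2 => [|b s2] in p H D U n0 lt21 *; first exact: Or32.
apply: Or33 => /=; apply/eqP/negPn/negP => b2; apply: D.
have ge2 x : x \in a :: s1 \/ x \in b :: s2 -> 1 < x.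
  move=> xs; have xe : x \in (a :: s1) ++ 1 :: b :: s2.
    by rewrite mem_cat [x \in 1 :: _]in_cons; case: xs => ->; rewrite ?orbT.
  have x1 : x != 1.
    move: U; rewrite cat_uniq /= negb_or => /and4P[_ /andP[n1 _] n2 _].
    by apply/eqP=> x1; case: xs; rewrite x1; apply/negP.
  by move: xe; rewrite (perm_mem p) mem_iota; lia.
have b1 : 1 < b by apply: ge2; right; rewrite mem_head.
(* The 2 is not before 1, where all letters exceed [b], and it is not [b]; so it comes after [b]. *)
have [u [v ev]] : exists u v, s2 = u ++ 2 :: v.
  have : 2 \in (a :: s1) ++ 1 :: b :: s2.
    rewrite (perm_mem p) mem_iota.
    have : b \in iota 1 k by rewrite -(perm_mem p) mem_cat !in_cons eqxx !orbT.
    by rewrite mem_iota; lia.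
  rewrite mem_cat [2 \in 1 :: _]in_cons [2 \in b :: _]in_cons.
  rewrite (eq_sym 2 b) (negPf b2) /= => /orP[h|/splitPr[u v]]; last by exists u, v.
  by have := lt21 2 b h (mem_head _ _); lia.
exists 0, 1, (last b u), (last a s1), a, b, 2, 1.
have xs : last b u \in b :: s2.
  by rewrite ev -cat_cons mem_cat mem_last.
split.
  split; first by rewrite /= mem_head.
  - by rewrite edges_cat mem_cat orbC /= !inE eqxx !orbT.
  - rewrite ev -!cat_cons (_ : _ ++ _ = ((a :: s1) ++ 1 :: b :: u) ++ 2 :: v); last first.
      by rewrite -catA.
    by have := edges_step 0 ((a :: s1) ++ 1 :: b :: u) 2 v; rewrite last_cat.
  - exact: (edges_step 0 (a :: s1)).
have x2 : 1 < last b u by apply: ge2; right.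
have xl : last b u < last a s1 by apply: lt21 => //; rewrite mem_last.
have ba : b < a by apply: lt21; rewrite mem_head.
by split; split => //; lia.
Qed.

(** * Listing and counting the good words *)

(** The words listed have [k.+1] letters. The third family omits words starting with 1, for which it
    would repeat the insertion at the front. *)
Fixpoint good_words (k : nat) : seq (seq nat) :=
  if k is k'.+1 then
    let W := good_words k' in
    [seq insert1 0 e | e <- W] ++ [seq insert1 (size e) e | e <- W] ++
    [seq insert1 (index 1 e) e | e <- W & index 1 e != 0]
  else [:: [:: 1]].

(** Soundness excludes 3421 as well as 4321, while completeness assumes only that 4321 is absent.
    The set to be counted lies between the two conditions, which therefore agree. *)
Lemma good_words_sound k e : e \in good_words k -> good_word false k.+1 e.
Proof.
elim: k e => [|k IH] e.
  rewrite inE => /eqP->; split=> //.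
    by move=> a b c /size_subseq.
  case=> i [j [k [l [x [y [z [t [[]]]]]]]]] /=; rewrite !inE.
  by move=> /orP[]/eqP[-> ->] /orP[]/eqP[-> ->] /orP[]/eqP[-> ->] _ [[]].
rewrite /= !mem_cat => /or3P[] /mapP[e'].
- by move/IH=> g ->; apply: good_word_insert1 g _; apply: Or31.
- by move/IH=> g ->; apply: good_word_insert1 g _; apply: Or32.
- by rewrite mem_filter => /andP[_ /IH g] ->; apply: good_word_insert1 g _; apply: Or33.
Qed.

Lemma good_words_complete k w : good_word true k.+1 w -> w \in good_words k.
Proof.
elim: k w => [|k IH] w gw; have [p _ _] := gw.
  by rewrite inE; apply/eqP/perm_small_eq.
have w1 : 1 \in w by rewrite (perm_mem p) mem_iota; lia.
case/splitPr: w1 => s1 s2 in gw p *.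
have U : uniq (s1 ++ 1 :: s2) by rewrite (perm_uniq p) iota_uniq.
have n0 := perm_iota1_notin0 p.
have SK s : {subset s <= s1 ++ 1 :: s2} -> map S (map predn s) = s.
  move=> sub; rewrite -map_comp -[RHS]map_id; apply/eq_in_map => x /sub /=.
  by case: x => // h; rewrite h in n0.
have S1 : map S (map predn s1) = s1 by apply: SK => x h; rewrite mem_cat h.
have S2 : map S (map predn s2) = s2.
  by apply: SK => x h; rewrite mem_cat in_cons h !orbT.
pose e := map predn s1 ++ map predn s2.
have we : s1 ++ 1 :: s2 = insert1 (size s1) e.
  by rewrite /insert1 /e take_size_cat ?drop_size_cat ?size_map // S1 S2.
have Hi : [\/ size s1 = 0, size s1 = size e | size s1 = index 1 e].
  case: (good_word_position gw) => [->|s20|h2]; first exact: Or31.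
    by apply: Or32; rewrite /e s20 cats0 size_map.
  (* Shifted down, the 2 heading [s2] becomes the 1 of [e], at index [size s1]; an earlier 1 would
     come from a second 2. *)
  apply: Or33; rewrite /e index_cat; case: ifP => [h|_]; last first.
    by case: s2 h2 {gw p U n0 SK S2 e we} => //= _ s2 ->; rewrite size_map eqxx addn0.
  have /mapP[x xs1 ex] := h.
  have e2 : 2 \in s1 by rewrite -S1 (map_f S h).
  have e2' : 2 \in 1 :: s2.
    by case: s2 h2 {gw p U n0 SK S2 e we} => //= _ s2 ->; rewrite !inE eqxx orbT.
  by move: U; rewrite cat_uniq => /and3P[_ /hasPn/(_ _ e2')]; rewrite /= e2.
rewrite we in gw *; have /IH ge := insert1_good_word gw Hi.
rewrite /= !mem_cat; have [i0|i0] := eqVneq (size s1) 0.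
  by rewrite i0 map_f.
case: Hi => [e0|->|ei]; first by rewrite e0 in i0.
  by rewrite (map_f (fun e => insert1 (size e) e)) ?orbT.
by rewrite ei (map_f (fun e => insert1 (index 1 e) e)) ?orbT // mem_filter -ei i0.
Qed.

Lemma index1_insert1 i e : 0 \notin e -> i <= size e -> index 1 (insert1 i e) = i.
Proof.
move=> n0 ie; rewrite /insert1 index_cat ifN.
  by rewrite /= addn0 size_map size_takel.
by apply/mapP=> -[x xe [x0]]; rewrite x0 (mem_take xe) in n0.
Qed.

(** Erasing 1 and shifting down recovers the word, wherever 1 was inserted. *)
Lemma insert1_inj i j e f : 0 \notin e -> 0 \notin f ->
  insert1 i e = insert1 j f -> e = f.
Proof.
have K m (w : seq nat) : 0 \notin w ->
    map predn (filter (predC1 1) (insert1 m w)) = w.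
  move=> n0; rewrite /insert1 filter_cat /=.
  rewrite -filter_cat -map_cat cat_take_drop (all_filterP _) ?mapK //.
  by apply/allP=> _ /mapP[x xw ->] /=; apply: contraNneq n0 => -[<-].
by move=> /(K i){2}<- /(K j){2}<- ->.
Qed.

Lemma good_words_index k e : e \in good_words k -> 0 \notin e /\ index 1 e < size e.
Proof.
case/good_words_sound=> p _ _; rewrite index_mem (perm_iota1_notin0 p).
by rewrite (perm_mem p) mem_iota.
Qed.

(** The index of 1 is 0 exactly in the first family. A word in both others would come from a single
    [e] with [index 1 e = size e], although [e] contains 1. *)
Lemma good_words_uniq k : uniq (good_words k).
Proof.
elim: k => //= k IH.
have inj (m : seq nat -> nat) :
    {in good_words k &, injective (fun e => insert1 (m e) e)}.
  move=> e f /good_words_index[e0 _] /good_words_index[f0 _]; exact: insert1_inj.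
rewrite !cat_uniq map_inj_in_uniq // ?IH //=.
rewrite map_inj_in_uniq // ?IH //= map_inj_in_uniq ?filter_uniq //; last first.
  by move=> e f; rewrite !mem_filter => /andP[_ he] /andP[_ hf]; apply: inj.
rewrite andbT; apply/andP; split; apply/hasPn => w.
  rewrite mem_cat => h; apply/mapP=> -[e /good_words_index[e0 _] we].
  have w0 : index 1 w = 0 by rewrite we index1_insert1.
  case/orP: h => /mapP[f]; rewrite ?mem_filter.
    move=> /good_words_index[f0 fi] wf.
    by move: w0 fi; rewrite wf index1_insert1 // => ->.
  move=> /andP[i0 /good_words_index[f0 fi]] wf.
  by move: w0 i0; rewrite wf index1_insert1 // => [->|]; rewrite // ltnW.
case/mapP=> f; rewrite mem_filter => /andP[i0 /good_words_index[f0 fi]] wf.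
apply/mapP=> -[e /good_words_index[e0 ei] we].
have ef : e = f := insert1_inj e0 f0 (etrans (esym we) wf).
have := congr1 (index 1) we; rewrite wf ef !index1_insert1 //; last by rewrite ltnW.
by move=> fe; rewrite fe ltnn in fi.
Qed.

Lemma size_good_words k : size (good_words k) = fib (2 * k).+1 /\
  count (fun e => index 1 e != 0) (good_words k) = fib (2 * k).
Proof.
elim: k => // k [IH1 IH2].
have f1 : fib (2 * k.+1) = fib (2 * k).+1 + fib (2 * k) by rewrite mulnS.
have f2 : fib (2 * k.+1).+1 = fib (2 * k.+1) + fib (2 * k).+1 by rewrite mulnS.
rewrite f2 f1 -IH1 -IH2 /= !size_cat !size_map size_filter; split; first by lia.
(* Every word of the first family begins with 1, and none of the other two families does. *)
rewrite !count_cat !count_map (eq_in_count (a2 := pred0)); last first.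
  by move=> e /good_words_index[e0 _]; rewrite /= index1_insert1.
rewrite (eq_in_count (a1 := preim _ _) (a2 := predT) (s := good_words k)); last first.
  by move=> e /good_words_index[e0 ei]; rewrite /= index1_insert1 // -lt0n (leq_ltn_trans _ ei).
rewrite (eq_in_count (a1 := preim _ _) (a2 := predT)); last first.
  move=> e; rewrite mem_filter => /andP[i0 /good_words_index[e0 ei]].
  by rewrite /= index1_insert1 ?i0 // ltnW.
by rewrite count_pred0 !count_predT size_filter.
Qed.

(** * Pattern containment through index maps *)

Lemma containsP (w t : seq nat) : reflect
  (exists2 g : nat -> nat, forall i, i < size t -> g i < size w &
    forall i j, i < j < size t -> g i < g j /\
      (nth 0 w (g j) < nth 0 w (g i)) = (nth 0 t j < nth 0 t i))
  (contains w t).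
Proof.
apply: (iffP existsP) => [[f /forallP H]|[g gw H]].
  exists (fun i => oapp (fun j : 'I_(size t) => val (f j)) 0 (insub i)).
    by move=> i it; rewrite insubT /= ltn_ord.
  move=> i j /andP[ij jt]; have it := ltn_trans ij jt.
  rewrite !insubT /=.
  by have /forallP/(_ (Ordinal jt)) /= := H (Ordinal it); rewrite ij /= => /andP[-> /eqP].
exists [ffun i : 'I_(size t) => Ordinal (gw i (ltn_ord i))].
apply/forallP=> i; apply/forallP=> j; apply/implyP=> ij; rewrite !ffunE /=.
by have [|-> ->] := H i j; rewrite ?ij ?ltn_ord ?eqxx.
Qed.

Lemma subseq_nthP (s w : seq nat) : reflect
  (exists2 g : nat -> nat,
     forall i, i < size s -> g i < size w /\ nth 0 w (g i) = nth 0 s i &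
     forall i j, i < j < size s -> g i < g j)
  (subseq s w).
Proof.
apply: (iffP idP) => [|[g gw gH]].
  elim: w s => [|y w IH] [|x s] //=; try by exists id => // i j; rewrite ltn0 andbF.
  case: eqP => [->|_] /IH[g gw gH].
    exists (fun i => if i is i'.+1 then (g i').+1 else 0).
      by case=> // i /gw.
    by case=> [|i] [|j] //=; rewrite ltnS => /gH.
  exists (fun i => (g i).+1); first by move=> i /gw.
  by move=> i j /gH.
have es : s = map (nth 0 w) (mkseq g (size s)).
  apply: (@eq_from_nth _ 0); rewrite ?size_map ?size_iota // => i si.
  by rewrite (nth_map 0) ?size_mkseq // nth_mkseq //; case: (gw _ si).
rewrite es -[X in subseq _ X](mkseq_nth 0) map_subseq //.
(* Both lists of indices are strictly increasing with the same members, hence equal. *)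
suff ->: mkseq g (size s) = [seq i <- iota 0 (size w) | i \in mkseq g (size s)].
  exact: filter_subseq.
apply: (irr_sorted_eq ltn_trans ltnn).
- apply/(sortedP 0) => i; rewrite size_mkseq => hi.
  by rewrite !nth_mkseq // ?(ltnW hi) //; apply: gH; rewrite ltnSn.
- by apply: sorted_filter; [exact: ltn_trans | exact: iota_ltn_sorted].
move=> i; rewrite mem_filter mem_iota /=.
case: (boolP (i \in _)) => //= /mapP[j]; rewrite mem_iota add0n => /andP[_ /gw[? _]] ->.
by symmetry.
Qed.

Lemma contains3P (w : seq nat) x y z : reflect
  (exists a b c : nat, subseq [:: a; b; c] w /\
    [/\ (b < a) = (y < x), (c < a) = (z < x) & (c < b) = (z < y)])
  (contains w [:: x; y; z]).
Proof.
apply: (iffP (containsP _ _)) => [[g gw H]|[a [b [c [/subseq_nthP[g gw gH] [H1 H2 H3]]]]]].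
  have [g01 e01] := H 0 1 isT; have [g12 e12] := H 1 2 isT; have [g02 e02] := H 0 2 isT.
  exists (nth 0 w (g 0)), (nth 0 w (g 1)), (nth 0 w (g 2)); split=> //.
  apply/subseq_nthP; exists g.
    by case=> [|[|[|i]]] // hi; split=> //; apply: gw.
  by move=> i j /H[].
exists g; first by move=> i /gw[].
have [_ e0] := gw 0 isT; have [_ e1] := gw 1 isT; have [_ e2] := gw 2 isT.
move=> i j ij; split; first exact: gH.
by case/andP: ij; case: i j => [|[|[|i]]] [|[|[|j]]] //= _ _; rewrite ?e0 ?e1 ?e2 /=.
Qed.

Lemma contains_map_succ w t : contains (map S w) t = contains w t.
Proof.
apply/containsP/containsP => -[g gw H]; exists g; rewrite ?size_map in gw *; try exact: gw.
  move=> i j /[dup] ij /H; rewrite !(nth_map 0) ?gw //; lia.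
move=> i j /[dup] ij /H; rewrite !(nth_map 0) ?gw //; lia.
Qed.

(** * Cyclic permutations and their words *)

Definition cycle_word m (s : 'S_m.+1) : seq nat := map val (traject s (s ord0) m).

Lemma cycle_formE m (s : 'S_m.+1) : cycle_form s = map S (0 :: cycle_word s).
Proof. by rewrite /cycle_form /cycle_word /= -map_comp. Qed.

Lemma cyclic_permP m (s : 'S_m.+1) :
  reflect (forall x, x \in traject s ord0 m.+1) (cyclic_perm s).
Proof.
apply: (iffP idP) => [|H].
  move=> /cards1P[A eA] x.
  have px y : porbit s y = A by apply/set1P; rewrite -eA imset_f.
  have pT : porbit s ord0 = setT.
    by apply/setP=> y; rewrite inE px -(px y) porbit_id.
  have := porbit_traject s ord0 x.
  by rewrite pT inE cardsT card_ord => <-.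
apply/cards1P; exists (porbit s ord0); apply/setP=> A; rewrite inE.
have px y : porbit s y = porbit s ord0.
  apply/eqP; rewrite eq_porbit_mem.
  by have /trajectP[i _ ->] := H y; rewrite -permX mem_porbit.
apply/imsetP/eqP => [[y _ ->]|->]; first exact: px.
by exists ord0.
Qed.

Lemma cyclic_traject_uniq m (s : 'S_m.+1) : cyclic_perm s -> uniq (traject s ord0 m.+1).
Proof.
move=> /cyclic_permP H; rewrite -[X in traject _ _ X](card_ord m.+1).
apply/card_uniqP; rewrite size_traject; apply: eq_card => x.
by rewrite inE card_ord H.
Qed.

Lemma cyclic_iter m (s : 'S_m.+1) : cyclic_perm s -> iter m.+1 s ord0 = ord0.
Proof.
move=> /cyclic_permP H.
have pT : porbit s ord0 = setT.
  apply/setP=> y; rewrite inE.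
  by have /trajectP[i _ ->] := H y; rewrite -permX mem_porbit.
by have := iter_porbit s ord0; rewrite pT cardsT card_ord.
Qed.

Lemma perm_cycle_word m (s : 'S_m.+1) : cyclic_perm s -> perm_eq (cycle_word s) (iota 1 m).
Proof.
move=> cs; rewrite -(perm_cons 0).
have -> : 0 :: cycle_word s = map val (traject s ord0 m.+1) by [].
rewrite -[0 :: _]/(iota 0 m.+1) -val_enum_ord perm_map //.
apply: uniq_perm; rewrite ?enum_uniq ?cyclic_traject_uniq // => x.
by rewrite mem_enum (cyclic_permP _ cs).
Qed.

Lemma nth_oneline (n : nat) (s : 'S_n) (i : 'I_n) : nth 0 (oneline s) i = (s i).+1.
Proof. by rewrite (nth_map i) ?size_enum_ord // nth_ord_enum. Qed.

Lemma size_oneline (n : nat) (s : 'S_n) : size (oneline s) = n.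
Proof. by rewrite size_map size_enum_ord. Qed.

Lemma edges_traject m (s : 'S_m.+1) x k : iter k.+1 s x = ord0 ->
  edges (val x) (map val (traject s (s x) k)) =
    [seq (val i, val (s i)) | i <- traject s x k.+1].
Proof.
elim: k x => [|k IH] x; first by move=> /= ->.
by rewrite iterSr => /IH /= ->.
Qed.

(** The bridge between the two notations: edges of the cycle are the position-value pairs of the
    one-line notation. *)
Lemma mem_edges_cycle_word m (s : 'S_m.+1) x y : cyclic_perm s ->
  ((x, y) \in edges 0 (cycle_word s)) =
    (x < m.+1) && (nth 0 (oneline s) x == y.+1).
Proof.
move=> cs; rewrite (edges_traject (cyclic_iter cs)).
apply/mapP/andP => [[i _ [-> ->]]|[xm]]; first by rewrite nth_oneline.
rewrite (nth_oneline s (Ordinal xm)) => /eqP[<-].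
by exists (Ordinal xm) => //; apply/(cyclic_permP _ cs).
Qed.

Lemma cycle_word_inj m (s t : 'S_m.+1) :
  cyclic_perm s -> cyclic_perm t -> cycle_word s = cycle_word t -> s = t.
Proof.
move=> cs ct est; apply/permP=> i; apply/val_inj.
have : (val i, val (s i)) \in edges 0 (cycle_word s).
  by rewrite mem_edges_cycle_word // nth_oneline ltn_ord eqxx.
by rewrite est mem_edges_cycle_word // nth_oneline => /andP[_ /eqP[]].
Qed.

Lemma cycle_word_surj m e : perm_eq e (iota 1 m) ->
  exists2 s : 'S_m.+1, cyclic_perm s & cycle_word s = e.
Proof.
move=> pe; pose c : seq 'I_m.+1 := map inord (0 :: e).
have ec : map val c = 0 :: e.
  rewrite /c -map_comp -[RHS]map_id; apply/eq_in_map => x /=.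
  rewrite inE (perm_mem pe) mem_iota => /orP[/eqP->|h]; rewrite inordK //; lia.
have pc : perm_eq c (enum 'I_m.+1).
  apply: (perm_map_inj val_inj); rewrite ec val_enum_ord.
  by rewrite /= perm_cons.
have Uc : uniq c by rewrite (perm_uniq pc) enum_uniq.
(* Each letter goes to its cyclic successor in [c], which is injective because [prev] undoes
   [next]. *)
pose s : 'S_m.+1 := perm (can_inj (prev_next Uc)).
have sz : size e = m by rewrite (perm_size pe) size_iota.
have c0 : c = ord0 :: map inord e.
  by congr (_ :: _); apply/val_inj; rewrite /= inordK.
have tc : traject s (s ord0) m = map inord e.
  have : fcycle s c.
    by rewrite (eq_fcycle (f' := next c)) ?cycle_next // => x; rewrite permE.
  rewrite c0 /= => /fpathP[k ek].
  have := congr1 size ek; rewrite size_rcons size_map sz size_traject => ekm.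
  by move: ek; rewrite -ekm trajectSr => /rcons_inj[].
exists s; last by rewrite /cycle_word tc; move: ec; rewrite c0 => -[].
apply/cyclic_permP => x.
by rewrite /= tc -c0 (perm_mem pc) mem_enum.
Qed.

Lemma cycle_wordV m (s : 'S_m.+1) : cyclic_perm s -> cycle_word s^-1 = rev (cycle_word s).
Proof.
move=> cs; have rt k x : rev (traject s (s x) k) = traject s^-1%g (iter k s x) k.
  elim: k => // k IH; rewrite trajectSr rev_rcons IH /= -iterSr iterS.
  by rewrite permK.
rewrite /cycle_word -map_rev rt; congr (map _ (traject _ _ _)).
(* The last letter of the cycle is the preimage of 0, where the word of the inverse starts. *)
by have := cyclic_iter cs; rewrite iterS => e; rewrite -[RHS](permK s) e.
Qed.

(** * Inversion and the equality of the two counts *)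

Lemma cyclic_permV m (s : 'S_m.+1) : cyclic_perm s^-1 = cyclic_perm s.
Proof. by rewrite /cyclic_perm porbitsV. Qed.

Lemma uniq_cycle_word m (s : 'S_m.+1) : cyclic_perm s -> uniq (cycle_word s).
Proof. by move=> /perm_cycle_word/perm_uniq->; apply: iota_uniq. Qed.

(** The leading 0 is the minimum and cannot be the 2 of a 213. *)
Lemma avoids_cycle_form213 m (s : 'S_m.+1) : cyclic_perm s ->
  avoids (cycle_form s) [:: 2; 1; 3] <-> avoids213 (cycle_word s).
Proof.
move=> cs; rewrite cycle_formE /avoids contains_map_succ; split=> [/contains3P H a b c sub|H].
  apply/negP=> /andP[ba ac]; apply: H; exists a, b, c; split; last by split; lia.
  exact: subseq_trans sub (subseq_cons _ _).
apply/contains3P=> -[a [b [c [sub [H1 H2 H3]]]]].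
have a0 : a == 0 = false by lia.
move: sub; rewrite /= a0 => sub.
have := subseq_uniq sub (uniq_cycle_word cs); rewrite /= !inE.
by move/H: sub; lia.
Qed.

(** Reversal turns 312 into 213, and the leading 0 cannot be the 3. *)
Lemma avoids_cycle_form312V m (s : 'S_m.+1) : cyclic_perm s ->
  avoids (cycle_form s^-1%g) [:: 3; 1; 2] <-> avoids213 (cycle_word s).
Proof.
move=> cs; rewrite cycle_formE cycle_wordV // /avoids contains_map_succ.
split=> [/contains3P H a b c sub|H].
  apply/negP=> /andP[ba ac]; apply: H; exists c, b, a; split; last by split; lia.
  apply: subseq_trans (subseq_cons _ _).
  by rewrite -[[:: c; b; a]]/(rev [:: a; b; c]) subseq_rev.
apply/contains3P=> -[a [b [c [sub [H1 H2 H3]]]]].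
have a0 : a == 0 = false by lia.
move: sub; rewrite /= a0 -[[:: a; b; c]]/(rev [:: c; b; a]) subseq_rev => sub.
have := subseq_uniq sub (uniq_cycle_word cs); rewrite /= !inE.
by move/H: sub; lia.
Qed.

(** Inversion exchanges positions and values, so it reflects an occurrence into an occurrence of the
    inverse pattern. *)
Lemma contains_oneline_inv n k (s : 'S_n) (t : 'S_k) :
  contains (oneline s) (oneline t) -> contains (oneline s^-1%g) (oneline t^-1%g).
Proof.
case: k t => [|k] t.
  by move=> _; apply/containsP; exists id => [i|i j]; rewrite size_oneline // ltn0 andbF.
case: n s => [|n] s.
  by case/containsP=> g /(_ 0); rewrite !size_oneline => /(_ isT).
case/containsP=> g; rewrite !size_oneline => gn H.
pose f (i : 'I_k.+1) : 'I_n.+1 := inord (g i).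
have fE i : f i = g i :> nat by rewrite inordK ?gn.
have fH (i j : 'I_k.+1) : i < j -> f i < f j /\ (s (f j) < s (f i)) = (t j < t i).
  move=> ij; have := H i j; rewrite ij ltn_ord => /(_ isT) [gij].
  by rewrite !fE gij -!fE !nth_oneline !ltnS.
have finj i j : f i = f j -> i = j.
  move=> eij; apply/val_inj.
  by case: (ltngtP i j) => // /fH[]; rewrite eij ltnn.
have val_lt (i j : 'I_k.+1) : (t i < t j) = (s (f i) < s (f j)).
  have [->|nij] := eqVneq i j; first by rewrite !ltnn.
  have tn : val (t i) != val (t j) by rewrite (inj_eq val_inj) (inj_eq perm_inj).
  have sn : val (s (f i)) != val (s (f j)).
    by rewrite (inj_eq val_inj) (inj_eq perm_inj); apply: contraNneq nij => /finj->.
  have [/fH[_ e]|/fH[_ //]|/val_inj e] := ltngtP i j; last by rewrite e eqxx in nij.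
  by move: e tn sn => /=; lia.
(* The value of [s] that plays the letter [v] of the pattern is a position of the inverse. *)
apply/containsP; pose h (v : nat) := val (s (f (t^-1%g (inord v)))).
exists h; first by move=> v _; rewrite size_oneline ltn_ord.
move=> u v; rewrite size_oneline => /andP[uv vk]; have uk := ltn_trans uv vk.
split; first by rewrite /h -val_lt !permKV !inordK.
have nthE w : w < k.+1 -> nth 0 (oneline t^-1%g) w = (t^-1%g (inord w)).+1.
  by move=> wk; rewrite -nth_oneline inordK.
rewrite /h !nth_oneline !permK !nthE // !ltnS.
have [/fH[-> _]|/fH[]|/val_inj->] := ltngtP (t^-1%g (inord v)) (t^-1%g (inord u)) => //.
  by move=> h1 _; apply/negbTE; rewrite -leqNgt ltnW.
by rewrite ltnn.
Qed.

(** As the reversal of four points, 4321 falls under the inversion lemmas and is its own inverse. *)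
Lemma oneline_rev_ord : [:: 4; 3; 2; 1] = oneline (perm (@rev_ord_inj 4)).
Proof.
apply: (@eq_from_nth _ 0); rewrite ?size_oneline // => i i4.
rewrite (nth_oneline _ (Ordinal i4)) permE /=.
by move: i i4 => [|[|[|[|i]]]].
Qed.

Lemma contains_oneline_invE n k (s : 'S_n) (t : 'S_k) :
  contains (oneline s^-1%g) (oneline t^-1%g) = contains (oneline s) (oneline t).
Proof.
apply/idP/idP; last exact: contains_oneline_inv.
by move/contains_oneline_inv; rewrite !invgK.
Qed.

Lemma contains_oneline4321V n (s : 'S_n) :
  contains (oneline s^-1%g) [:: 4; 3; 2; 1] = contains (oneline s) [:: 4; 3; 2; 1].
Proof.
rewrite oneline_rev_ord -{1}[perm _]invgK -[RHS]contains_oneline_invE.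
congr contains; congr oneline; rewrite invgK; apply/permP=> i.
by apply: (@perm_inj _ (perm (@rev_ord_inj 4))); rewrite permKV !permE rev_ordK.
Qed.

Lemma a_numV n k (t : 'S_k) :
  a_num n [:: oneline t; [:: 4; 3; 2; 1]] [:: 2; 1; 3] =
  a_num n [:: oneline t^-1%g; [:: 4; 3; 2; 1]] [:: 3; 1; 2].
Proof.
case: n => [|m].
  (* For [n = 0] there are no orbits, so no permutation counts as cyclic and both sets are empty. *)
  rewrite /a_num; apply: eq_card => s; rewrite !inE /cyclic_perm.
  rewrite [porbits s](_ : _ = set0) ?cards0 //.
  by apply/setP=> A; rewrite inE; apply/imsetP=> -[[]].
rewrite /a_num -(card_imset _ invg_inj); apply: eq_card => s.
have -> (A : {set 'S_m.+1}) : (s \in [set x^-1%g | x in A]) = (s^-1%g \in A).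
  by rewrite -{1}[s]invgK (mem_imset _ _ invg_inj).
rewrite !inE cyclic_permV /= !andbT; case: (boolP (cyclic_perm s)) => //= cs.
rewrite {1 2}/avoids contains_oneline4321V -{1}[t]invgK contains_oneline_invE.
have csV : cyclic_perm s^-1%g by rewrite cyclic_permV.
have H213 := avoids_cycle_form213 csV.
have H312 := avoids_cycle_form312V csV; rewrite invgK in H312.
by congr (_ && _); apply/idP/idP => h; [apply/H312/H213|apply/H213/H312].
Qed.

(** * From good words to the count of permutations *)

Lemma contains4321_descent_pattern m (s : 'S_m.+1) : cyclic_perm s ->
  descent_pattern true (edges 0 (cycle_word s)) -> contains (oneline s) [:: 4; 3; 2; 1].
Proof.
move=> cs [i [j [k [l [x [y [z [t [[]]]]]]]]]].
rewrite !mem_edges_cycle_word // => /andP[i1 /eqP i2] /andP[j1 /eqP j2].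
move=> /andP[k1 /eqP k2] /andP[l1 /eqP l2] [[ij jk kl] [tz zx zy /= yx]].
apply/containsP; exists (nth 0 [:: i; j; k; l]); rewrite ?size_oneline.
  by case=> [|[|[|[|u]]]].
move=> u v /andP[]; case: u v => [|[|[|[|u]]]] [|[|[|[|v]]]] //= _ _;
  rewrite ?i2 ?j2 ?k2 ?l2; lia.
Qed.

(** As [4 <= k], the first two letters of [t] precede the final 21 and exceed 2; with it they form a
    4321 or a 3421. *)
Lemma descent_pattern_contains m (s : 'S_m.+1) k (t : 'S_k) : 4 <= k ->
  nth 0 (oneline t) (k - 2) = 2 -> nth 0 (oneline t) (k - 1) = 1 ->
  cyclic_perm s -> contains (oneline s) (oneline t) ->
  descent_pattern false (edges 0 (cycle_word s)).
Proof.
move=> k4 t2 t1 cs /containsP[g]; rewrite !size_oneline => gm H.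
have big i : i < k - 2 -> 2 < nth 0 (oneline t) i.
  move=> ik; have ik' : i < k by lia.
  have Ut : uniq (oneline t).
    by rewrite map_inj_uniq ?enum_uniq // => u v [/val_inj/perm_inj].
  have : nth 0 (oneline t) i != 2 by rewrite -t2 nth_uniq ?size_oneline //; lia.
  have : nth 0 (oneline t) i != 1 by rewrite -t1 nth_uniq ?size_oneline //; lia.
  by rewrite (nth_oneline t (Ordinal ik')); lia.
have pos i : i < m.+1 -> exists y, nth 0 (oneline s) i = y.+1.
  by move=> im; exists (s (Ordinal im)); rewrite -nth_oneline.
have [x ex] := pos _ (gm 0 (ltac:(lia))).
have [y ey] := pos _ (gm 1 (ltac:(lia))).
have [z ez] := pos _ (gm (k - 2) (ltac:(lia))).
have [v ev] := pos _ (gm (k - 1) (ltac:(lia))).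
have [g01 _] := H 0 1 (ltac:(lia)).
have [g12 _] := H 1 (k - 2) (ltac:(lia)).
have [_ h1] := H 1 (k - 2) (ltac:(lia)).
have [_ h0] := H 0 (k - 2) (ltac:(lia)).
have [g23 h2] := H (k - 2) (k - 1) (ltac:(lia)).
have b0 := big 0 (ltac:(lia)); have b1 := big 1 (ltac:(lia)).
rewrite ex ey ez ev t2 t1 ?b0 ?b1 in h0 h1 h2.
exists (g 0), (g 1), (g (k - 2)), (g (k - 1)), x, y, z, v.
rewrite !mem_edges_cycle_word // ex ey ez ev !eqxx !andbT.
by split; [split; apply: gm; lia | split; split => //; lia].
Qed.

Lemma a_num_fib k (tau : 'S_k) n : 4 <= k ->
  nth 0 (oneline tau) (k - 2) = 2 -> nth 0 (oneline tau) (k - 1) = 1 -> 2 <= n ->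
  a_num n [:: oneline tau; [:: 4; 3; 2; 1]] [:: 2; 1; 3] = fib (2 * n - 3).
Proof.
case: n => [|[|m]] // k4 t2 t1 _.
(* Here [n = m.+2], and the words have [m.+1] letters, as in [good_words m]. *)
have -> : 2 * m.+2 - 3 = (2 * m).+1 by lia.
have [<- _] := size_good_words m.
rewrite /a_num; set A := A_set _ _ _.
have memA s : (s \in A) = cyclic_perm s && (cycle_word s \in good_words m).
  rewrite inE /= andbT; case: (boolP (cyclic_perm s)) => //= cs.
  apply/idP/idP => [/andP[/andP[_ a4321] /(avoids_cycle_form213 cs) a213]|].
    apply: good_words_complete; split=> //; first exact: perm_cycle_word.
    by move/(contains4321_descent_pattern cs); apply/negP.
  move/good_words_sound=> [_ a213 nd]; rewrite (introT idP (_ : avoids (cycle_form s) _)).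
    rewrite andbT; apply/andP; split; apply/negP => c; apply: nd.
      exact: descent_pattern_contains c.
    (* 4321 itself ends in 21, so the argument for [tau] applies to it. *)
    move: c; rewrite oneline_rev_ord; apply: descent_pattern_contains => //.
      by rewrite -oneline_rev_ord.
    by rewrite -oneline_rev_ord.
  exact/(avoids_cycle_form213 cs).
rewrite -(size_image (@cycle_word m.+1)); apply: perm_size; apply: uniq_perm.
- rewrite map_inj_in_uniq ?enum_uniq // => s t; rewrite !mem_enum !memA.
  by move=> /andP[cs _] /andP[ct _]; apply: cycle_word_inj.
- exact: good_words_uniq.
move=> e; apply/imageP/idP => [[s]|eg].
  by rewrite memA => /andP[_ h] ->.
have [pe _ _] := good_words_sound eg.
by have [s cs es] := cycle_word_surj pe; exists s; rewrite ?memA ?cs -?es // es.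
Qed.

Theorem theorem3p4 (k : nat) (hk : 4 <= k) (tau : 'S_k)
    (htau2 : nth 0 (oneline tau) (k - 2) = 2)
    (htau1 : nth 0 (oneline tau) (k - 1) = 1)
    (n : nat) (hn : 2 <= n) :
  a_num n [:: oneline tau; [:: 4; 3; 2; 1]] [:: 2; 1; 3]
    = a_num n [:: oneline (tau^-1)%g; [:: 4; 3; 2; 1]] [:: 3; 1; 2]
  /\ a_num n [:: oneline (tau^-1)%g; [:: 4; 3; 2; 1]] [:: 3; 1; 2]
    = fib (2 * n - 3).
Proof. by rewrite -a_numV (a_num_fib hk). Qed.
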